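(* Suppose Assumption 1 (stated in the context) holds. Then, for any level $\ell=1,2,\dots,\mathsf{L}$: (1) The Markov chain on $(\mathsf{X}^2,\mathcal{B}(\mathsf{X}^2))$ generated by the joint kernel $\bm p_\ell$ has a unique invariant probability measure $\nu_\ell$. (2) This chain is uniformly ergodic: there exist a bounded, $\nu_\ell$-integrable function $V_{\ell-1,\ell}:\mathsf{X}^2\to[1,V_{\max,\ell}]$ (with $V_{\max,\ell}<\infty$), constants $r\in(0,1)$ and $M\in(0,\infty)$ such that $$\sup_{|f|\le V_{\ell-1,\ell}}\Big|(\bm P_\ell^n f)(\bm\theta_\ell)-\int_{\mathsf{X}^2} f\,\mathrm{d}\nu_\ell\Big|\le M V_{\max,\ell}\, r^n\qquad\forall \bm\theta_\ell\in\mathsf{X}^2,\ n\in\mathbb{N},$$ where the supremum is over all $\nu_\ell$-measurable $f:\mathsf{X}^2\to\mathbb{R}$ with $|f(\bm\theta_\ell)|\le V_{\ell-1,\ell}(\bm\theta_\ell)$ for all $\bm\theta_\ell\in\mathsf{X}^2$.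
   Context: Setting: $\mathsf{X}$ is a separable Banach space with Borel $\sigma$-algebra $\mathcal{B}(\mathsf{X})$, $\mu_{\mathrm{pr}}$ is a (prior) probability measure on $\mathsf{X}$. For levels $j=0,1,\dots,\mathsf{L}$, $\mu^y_j$ is a probability measure (posterior) on $\mathsf{X}$ with density $\pi^y_j$ with respect to $\mu_{\mathrm{pr}}$. For $\ell=1,\dots,\mathsf{L}$, $Q_\ell$ is a probability density with respect to $\mu_{\mathrm{pr}}$ (the independent proposal). For $j\in\{\ell-1,\ell\}$ and $\theta,z\in\mathsf{X}$ define the acceptance probability $\alpha_j(\theta,z)=\min\{1,\frac{\pi^y_j(z)Q_\ell(\theta)}{\pi^y_j(\theta)Q_\ell(z)}\}$. Joint kernel: for $\bm\theta_\ell=(\theta_{\ell,\ell-1},\theta_{\ell,\ell})\in\mathsf{X}^2$ and $A\in\mathcal{B}(\mathsf{X}^2)$, $\bm p_\ell(\bm\theta_\ell,A)=\int_\mathsf{X}\min\{\alpha_{\ell-1}(\theta_{\ell,\ell-1},z),\alpha_\ell(\theta_{\ell,\ell},z)\}\mathbf 1_{\{(z,z)\in A\}}Q_\ell(z)\mu_{\mathrm{pr}}(\mathrm{d}z)+\int_\mathsf{X}(\alpha_{\ell-1}(\theta_{\ell,\ell-1},z)-\alpha_\ell(\theta_{\ell,\ell},z))^+\mathbf 1_{\{(z,\theta_{\ell,\ell})\in A\}}Q_\ell(z)\mu_{\mathrm{pr}}(\mathrm{d}z)+\int_\mathsf{X}(\alpha_\ell(\theta_{\ell,\ell},z)-\alpha_{\ell-1}(\theta_{\ell,\ell-1},z))^+\mathbf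 1_{\{(\theta_{\ell,\ell-1},z)\in A\}}Q_\ell(z)\mu_{\mathrm{pr}}(\mathrm{d}z)+\mathbf 1_{\{\bm\theta_\ell\in A\}}\big(1-\int_\mathsf{X}\max\{\alpha_{\ell-1}(\theta_{\ell,\ell-1},z),\alpha_\ell(\theta_{\ell,\ell},z)\}Q_\ell(z)\mu_{\mathrm{pr}}(\mathrm{d}z)\big)$. (This is the kernel of two independent Metropolis–Hastings chains targeting $\mu^y_{\ell-1},\mu^y_\ell$ that share the same proposal $z\sim Q_\ell\mu_{\mathrm{pr}}$ and the same uniform random number for acceptance.) $\bm P_\ell$ denotes the associated Markov operator $(\bm P_\ell f)(\bm\theta)=\int f(\bm\eta)\bm p_\ell(\bm\theta,\mathrm{d}\bm\eta)$. Assumption 1: for all $\ell=1,\dots,\mathsf{L}$: (1.1) $Q_\ell$ is continuous and $Q_\ell(z)>0$ for all $z\in\mathsf{X}$; (1.2) $\pi^y_\ell$ is continuous and $\pi^y_\ell(z)>0$ for all $z$ (for all levels); (1.3) for $j=\ell-1,\ell$ and every $c_r>0$, the set $\{\theta\in\mathsf{X}: Q_\ell(\theta)/\pi^y_j(\theta)\le c_r\}$ is compact; (1.4) there exists $c\in(0,1)$ independent of $\ell$ with $\operatorname{ess\,inf}_{z\in\mathsf{X}}Q_\ell(z)/\pi^y_j(z)\ge c$ for $j=\ell-1,\ell$; (1.5) there exist $r>1$, $C_r>0$ independent of $\ell$ with $\int_\mathsf{X}Q_\ell^r\,\mathrm{d}\mu_{\mathrm{pr}}\le C_r$. *)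

(* Defs.v *)
From HB Require Import structures.
From mathcomp Require Import all_boot all_order all_algebra.
From mathcomp Require Import all_classical all_reals all_analysis.
From mathcomp Require Import ess_sup_inf.

Set Implicit Arguments.
Unset Strict Implicit.
Unset Printing Implicit Defensive.
Import Order.TTheory GRing.Theory Num.Theory.
Import numFieldNormedType.Exports.
Local Open Scope classical_set_scope.
Local Open Scope ring_scope.

Definition borel (T : topologicalType) := g_sigma_algebraType (@open T).

Definition separable_space (T : topologicalType) : Prop :=
  exists D : set T, countable D /\ closure D = setT.

Section MLMCMH.
Context {R : realType} {V : normedModType R}.

Definition is_density (mu : {measure set (borel V) -> \bar R}) (g : V -> R) :=
  (forall x, 0 <= g x) /\ measurable_fun setT (g : borel V -> R) /\
  (\int[mu]_x (g x)%:E = 1)%E.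

(* acceptance probability of the independent MH sampler, target density pi,
   proposal density Q *)
Definition alpha (pi Q : V -> R) (th z : V) : R :=
  Num.min 1 (pi z * Q th / (pi th * Q z)).

(* Markov operator (P f)(theta) = int f(eta) p(theta, d eta) of the coupled
   kernel: pa = pi_{l-1}, pb = pi_l, Q = Q_l. *)
Definition Pop (mu : {measure set (borel V) -> \bar R}) (pa pb Q : V -> R)
    (f : V * V -> R) (th : V * V) : R :=
  \int[mu]_z (Num.min (alpha pa Q th.1 z) (alpha pb Q th.2 z) * f (z, z) * Q z)
  + \int[mu]_z (Num.max 0 (alpha pa Q th.1 z - alpha pb Q th.2 z)
                  * f (z, th.2) * Q z)
  + \int[mu]_z (Num.max 0 (alpha pb Q th.2 z - alpha pa Q th.1 z)
                  * f (th.1, z) * Q z)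
  + f th * (1 - \int[mu]_z (Num.max (alpha pa Q th.1 z) (alpha pb Q th.2 z)
                             * Q z)).

(* The joint kernel p_l(theta, A): the operator applied to the indicator 1_A,
   which is literally the defining formula of p_l. *)
Definition pker (mu : {measure set (borel V) -> \bar R}) (pa pb Q : V -> R)
    (th : V * V) (A : set (V * V)) : R :=
  Pop mu pa pb Q (fun eta => \1_A eta) th.

Definition kernel_invariant (mu : {measure set (borel V) -> \bar R}) (pa pb Q : V -> R)
    (nu : {measure set (borel (V * V)%type) -> \bar R}) : Prop :=
  forall A : set (borel (V * V)%type), measurable A ->
    nu A = (\int[nu]_t (pker mu pa pb Q t A)%:E)%E.

End MLMCMH.

(* Main.v *)
Require Import Defs.
From HB Require Import structures.
From mathcomp Require Import all_boot all_order all_algebra.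
From mathcomp Require Import all_classical all_reals all_analysis.
From mathcomp Require Import ess_sup_inf measurable_realfun finmap ring lra.

Set Implicit Arguments.
Unset Strict Implicit.
Unset Printing Implicit Defensive.
Import Order.TTheory GRing.Theory Num.Theory.
Import numFieldNormedType.Exports.
Local Open Scope classical_set_scope.
Local Open Scope ring_scope.

(* The coupled chain satisfies a Doeblin condition on the whole space. The ratio
   Q/pi_j is continuous and positive with a compact sublevel set, so pi_j <= M Q
   everywhere for some M, and then alpha_j(th, z) Q(z) >= pi_j(z) / M. Hence
   both chains jump to a common point at least as often as under the measure
   min(pi_{l-1}, pi_l) mu / M carried by the diagonal, which has positive mass.

   A Markov operator P with P f >= beta E f for all bounded f >= 0, where E is
   the integral against some probability measure, shrinks the range of every
   bounded f by the factor 1 - beta, so P^n f tends uniformly and geometrically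
   to a constant L f. As a uniform limit of integrals, L is linear and
   continuous under bounded pointwise convergence, hence is itself the integral
   against a probability measure nu. This nu is invariant because
   L (P f) = L f, and it is the only invariant measure because any invariant
   nu' satisfies nu'(f) = nu'(P^n f) -> L f. *)

Section bounded_measurable.
Context {d : measure_display} {T : measurableType d} {R : realType}.
Implicit Types f g : T -> R.

Definition bounded_mfun f :=
  measurable_fun setT f /\ exists C : R, forall t, `|f t| <= C.

Definition bounded_cvg (fn : (T -> R)^nat) f :=
  [/\ forall n, measurable_fun setT (fn n),
      exists C : R, forall n t, `|fn n t| <= C &
      forall t, fn ^~ t @ \oo --> f t].

Lemma bounded_mfun_cst (c : R) : bounded_mfun (cst c).
Proof. by split; last exists `|c|. Qed.

Lemma bounded_mfun_linear (a : R) f g :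
  bounded_mfun f -> bounded_mfun g -> bounded_mfun (a \*o f \+ g).
Proof.
move=> [mf [C fC]] [mg [D gD]]; split.
  by apply: measurable_funD => //; exact: measurable_funM.
exists (`|a| * C + D) => t.
by rewrite (le_trans (ler_normD _ _))// lerD// normrM ler_wpM2l.
Qed.

Lemma bounded_mfun_affine (a b : R) f :
  bounded_mfun f -> bounded_mfun (a \*o f \+ cst b).
Proof. by move=> bf; exact: bounded_mfun_linear bf (bounded_mfun_cst b). Qed.

Lemma bounded_mfun_lincomb (I : Type) (r : seq I) (a : I -> R)
    (g_ : I -> T -> R) : (forall i, bounded_mfun (g_ i)) ->
  bounded_mfun (fun t => \sum_(i <- r) a i * g_ i t).
Proof.
move=> bg; elim: r => [|i r bs].
  by under eq_fun do rewrite big_nil; exact: bounded_mfun_cst.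
under eq_fun do rewrite big_cons.
exact: (bounded_mfun_linear (a i) (bg i) bs).
Qed.

Lemma bounded_mfunM f g :
  bounded_mfun f -> bounded_mfun g -> bounded_mfun (f \* g).
Proof.
move=> [mf [C fC]] [mg [D gD]]; split; first exact: measurable_funM.
by exists (C * D) => t; rewrite normrM ler_pM.
Qed.

Lemma bounded_mfun_indic (A : set T) : measurable A ->
  bounded_mfun (\1_A : T -> R).
Proof.
move=> mA; split; first exact: measurable_indic.
by exists 1 => t; rewrite indicE; case: (_ \in _); rewrite ?normr1 ?normr0.
Qed.

Lemma bounded_mfun_integrable (mu : {finite_measure set T -> \bar R}) f :
  bounded_mfun f -> mu.-integrable setT (EFin \o f).
Proof.
move=> [mf [C fC]]; apply: measurable_bounded_integrable => //.
  by rewrite -ge0_fin_numE// fin_num_measure.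
by exists C; split; [exact: num_real|move=> x Cx t _; exact: le_trans (ltW Cx)].
Qed.

Lemma bounded_cvg_seq fn f n : bounded_cvg fn f -> bounded_mfun (fn n).
Proof. by move=> [mfn [C fC] _]; split=> //; exists C. Qed.

Lemma bounded_cvg_lim fn f : bounded_cvg fn f -> bounded_mfun f.
Proof.
move=> [mfn [C fC] fn_f]; split.
  by apply: measurable_fun_cvg mfn _ => t _; exact: fn_f.
exists C => t; have /cvg_norm f_t := fn_f t.
by rewrite -(cvg_lim _ f_t)//; apply: limr_le; [exact: cvgP f_t|exact: nearW].
Qed.

Lemma bounded_cvg_sum_indic (F : (set T)^nat) : (forall n, measurable (F n)) ->
  trivIset setT F ->
  bounded_cvg (fun n t => \sum_(0 <= i < n) \1_(F i) t)
    (\1_(\bigcup_n F n) : T -> R).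
Proof.
move=> mF tF.
have sumE n t : ((\sum_(0 <= i < n) \1_(F i) t)%:E =
    \sum_(0 <= i < n) \d_t (F i))%E.
  by rewrite -sumEFin; apply: eq_bigr => i _; rewrite diracE indicE.
split=> [n||t].
- by apply: measurable_sum => i; exact: measurable_indic.
- exists 1 => n t; rewrite ger0_norm; last exact: sumr_ge0.
  rewrite -lee_fin sumE big_mkord -measure_bigsetU//.
  by apply: probability_le1; exact: bigsetU_measurable.
- have mUF : measurable (\bigcup_n F n) by exact: bigcup_measurable.
  pose dt : {measure set T -> \bar R} := \d_t.
  have := @measure_semi_sigma_additive _ _ _ dt F mF tF mUF.
  under eq_fun do rewrite -sumE.
  by move=> /fine_cvgP[_]; apply.
Qed.

End bounded_measurable.

Lemma bounded_mfun_comp {d d' : measure_display} {S : measurableType d}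
    {T : measurableType d'} {R : realType} (h : S -> T) (f : T -> R) :
  bounded_mfun f -> measurable_fun setT h -> bounded_mfun (f \o h).
Proof.
move=> [mf [C fC]] mh; split; first exact: measurableT_comp.
by exists C => s; exact: fC.
Qed.

Section mean.
Context {d : measure_display} {T : measurableType d} {R : realType}.
Implicit Types (E : (T -> R) -> R) (f g : T -> R).

(* Nothing is required of [E] outside the bounded measurable functions. *)
Record is_mean E : Prop := IsMean {
  mean_linear : forall (a : R) f g, bounded_mfun f -> bounded_mfun g ->
    E (a \*o f \+ g) = a * E f + E g ;
  mean_cst : forall c, E (cst c) = c ;
  mean_ge0 : forall f, bounded_mfun f -> (forall t, 0 <= f t) -> 0 <= E f ;
  mean_cvg : forall (fn : (T -> R)^nat) f, bounded_cvg fn f ->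
    E (fn n) @[n --> \oo] --> E f }.

Lemma is_mean_eval (t : T) : is_mean (fun f => f t).
Proof. by split=> // fn f []. Qed.

Lemma eq_is_mean E E' : (forall f, bounded_mfun f -> E f = E' f) ->
  is_mean E -> is_mean E'.
Proof.
move=> EE' mE; split=> [a f g bf bg|c|f bf f0|fn f fn_f].
- by rewrite -!EE' ?(mean_linear mE)//; exact: bounded_mfun_linear.
- by rewrite -EE' ?(mean_cst mE)//; exact: bounded_mfun_cst.
- by rewrite -EE'//; exact: (mean_ge0 mE bf f0).
- rewrite -(EE' _ (bounded_cvg_lim fn_f)).
  under eq_fun do rewrite -(EE' _ (bounded_cvg_seq _ fn_f)).
  exact: mean_cvg.
Qed.

Variable E : (T -> R) -> R.
Hypothesis mE : is_mean E.

Lemma mean_affine (a b : R) f : bounded_mfun f ->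
  E (a \*o f \+ cst b) = a * E f + b.
Proof.
move=> bf; rewrite (mean_linear mE) ?(mean_cst mE)//.
exact: bounded_mfun_cst.
Qed.

Lemma mean_range (a b : R) f : bounded_mfun f -> (forall t, a <= f t <= b) ->
  a <= E f <= b.
Proof.
move=> bf fab.
have : 0 <= E (1 \*o f \+ cst (- a)).
  apply: (mean_ge0 mE) => [|t /=]; first exact: bounded_mfun_affine.
  by have := fab t; lra.
have : 0 <= E (-1 \*o f \+ cst b).
  apply: (mean_ge0 mE) => [|t /=]; first exact: bounded_mfun_affine.
  by have := fab t; lra.
by rewrite !mean_affine//; lra.
Qed.

Lemma mean_norm_le (C : R) f : bounded_mfun f -> (forall t, `|f t| <= C) ->
  `|E f| <= C.
Proof.
move=> bf fC; rewrite ler_norml; apply: mean_range => // t.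
by rewrite -ler_norml.
Qed.

Lemma mean_lincomb (I : Type) (r : seq I) (a : I -> R) (g_ : I -> T -> R) :
  (forall i, bounded_mfun (g_ i)) ->
  E (fun t => \sum_(i <- r) a i * g_ i t) = \sum_(i <- r) a i * E (g_ i).
Proof.
move=> bg; elim: r => [|i r IHr].
  by under eq_fun do rewrite big_nil; rewrite big_nil (mean_cst mE).
under eq_fun do rewrite big_cons.
rewrite big_cons -IHr -(mean_linear mE)//.
exact: bounded_mfun_lincomb.
Qed.

End mean.

Section mean_extensionality.
Context {d : measure_display} {T : measurableType d} {R : realType}.
Variables E E' : (T -> R) -> R.
Hypotheses (mE : is_mean E) (mE' : is_mean E').
Hypothesis eqE : forall A, measurable A -> E \1_A = E' \1_A.
Import HBNNSimple.

Lemma eq_mean_sfun (h : {nnsfun T >-> R}) : E h = E' h.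
Proof.
have -> : (h : T -> R) =
    fun t => \sum_(y <- fset_set (range h)) y * \1_(h @^-1` [set y]) t.
  by apply/funext => t; rewrite fimfunE fsbig_finite.
have bh y : bounded_mfun (\1_(h @^-1` [set y]) : T -> R).
  exact/bounded_mfun_indic/measurable_funPTI.
rewrite (mean_lincomb mE)// (mean_lincomb mE')//.
by apply: eq_bigr => y _; rewrite eqE//; exact: measurable_funPTI.
Qed.

Lemma eq_mean_ge0 (f : T -> R) : bounded_mfun f -> (forall t, 0 <= f t) ->
  E f = E' f.
Proof.
move=> [mf [C fC]] f0.
have mEf : measurable_fun setT (EFin \o f) by exact/measurable_EFinP.
have Ef0 t : setT t -> (0 <= (f t)%:E)%E by rewrite lee_fin.
pose fn := nnsfun_approx measurableT mEf.
have fn_f : bounded_cvg (fn : (T -> R)^nat) f.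
  split=> [n|| t]; first exact: measurable_funP.
    exists C => n t; rewrite ger0_norm// (le_trans _ (fC t))//.
    rewrite (le_trans _ (ler_norm _))// -lee_fin /fn nnsfun_approxE.
    exact: le_approx Ef0 I.
  by have /fine_cvgP[] := cvg_nnsfun_approx measurableT mEf Ef0 (I : setT t).
apply: (cvg_unique _ (mean_cvg mE fn_f)) => //.
rewrite /=; under eq_fun do rewrite eq_mean_sfun; exact: mean_cvg.
Qed.

Lemma eq_mean (f : T -> R) : bounded_mfun f -> E f = E' f.
Proof.
move=> bf; have [mf [C fC]] := bf.
have : E (1 \*o f \+ cst C) = E' (1 \*o f \+ cst C).
  apply: eq_mean_ge0 => [|t /=]; first exact: bounded_mfun_affine.
  by have := fC t; rewrite ler_norml mul1r => /andP[+ _]; lra.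
by rewrite !mean_affine// !mul1r => /addIr.
Qed.

End mean_extensionality.

Section mean_mixture.
Context {d d' : measure_display} {T : measurableType d} {S : measurableType d'}.
Context {R : realType} (mu : {measure set S -> \bar R}) (w : S -> R).
Hypothesis w_int : mu.-integrable setT (EFin \o w).

Lemma bounded_mfunM_integrable (g : S -> R) : bounded_mfun g ->
  mu.-integrable setT (EFin \o (g \* w)).
Proof.
move=> [mg [C gC]].
have mw : measurable_fun setT w by exact/measurable_EFinP/(measurable_int mu).
apply: (le_integrable measurableT _ _ (integrableZl measurableT C w_int)).
  by apply/measurable_EFinP; exact: measurable_funM.
move=> s _ /=; rewrite lee_fin !normrM ler_wpM2r//.
exact: le_trans (gC s) (ler_norm _).
Qed.

Hypotheses (w_ge0 : forall s, 0 <= w s) (w_mass : \int[mu]_s w s = 1).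

Lemma is_mean_mixture (K : (T -> R) -> S -> R) :
  (forall f, bounded_mfun f -> measurable_fun setT (K f)) ->
  (forall s, is_mean (K ^~ s)) -> is_mean (fun f => \int[mu]_s (K f s * w s)).
Proof.
move=> mK meanK.
have bK f : bounded_mfun f -> bounded_mfun (K f).
  move=> bf; split; first exact: mK.
  have [_ [C fC]] := bf; exists C => s.
  exact: (mean_norm_le (meanK s) bf fC).
have iK f bf := bounded_mfunM_integrable (bK f bf).
split=> [a f g bf bg|c|f bf f0|fn f fn_f].
- rewrite -RintegralZl//; last exact: iK.
  have iaK := integrableZl measurableT a (iK _ bf).
  rewrite -RintegralD//; last exact: iK.
  apply: eq_Rintegral => s _.
  by rewrite (mean_linear (meanK s))// mulrDl mulrA.
- under eq_Rintegral do rewrite (mean_cst (meanK _)).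
  by rewrite RintegralZl// w_mass mulr1.
- apply: Rintegral_ge0 => s _; apply: mulr_ge0 => //.
  exact: (mean_ge0 (meanK s) bf f0).
- have [_ [C fC] _] := fn_f.
  have bfn n := bounded_cvg_seq n fn_f; have bf := bounded_cvg_lim fn_f.
  apply: fine_cvg.
  rewrite fineK; last exact: (integrable_fin_num measurableT (iK _ bf)).
  apply: (@dominated_cvg _ _ _ mu setT measurableT _ _
    (fun s => (C%:E * (w s)%:E)%E)) => //.
  + by move=> n; exact: measurable_int (iK _ (bfn n)).
  + move=> s _; apply/cvg_EFin; first exact: nearW.
    by apply: cvgMl; exact: (mean_cvg (meanK s) fn_f).
  + exact: (integrableZl measurableT C w_int).
  + move=> n s _; rewrite lee_fin normrM (ger0_norm (w_ge0 s)) ler_wpM2r//.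
    exact: (mean_norm_le (meanK s) (bfn n) (fC n)).
Qed.

End mean_mixture.

Section mean_representation.
Context {d : measure_display} {T : measurableType d} {R : realType}.

Lemma Rintegral_indic (mu : {measure set T -> \bar R}) (A : set T) :
  measurable A -> \int[mu]_t \1_A t = fine (mu A).
Proof. by move=> mA; rewrite /Rintegral integral_indic// setIT. Qed.

Lemma is_mean_Rintegral (nu : probability T R) :
  is_mean (fun f => \int[nu]_t f t).
Proof.
have i1 := bounded_mfun_integrable nu (bounded_mfun_cst 1).
apply: eq_is_mean (is_mean_mixture i1 _ _ _ (@is_mean_eval _ T R)) => //.
- by move=> f _; under eq_Rintegral do rewrite mulr1.
- by rewrite Rintegral_cst// [X in fine X](probability_setT nu) mulr1.
- by move=> f [].
Qed.

Variable E : (T -> R) -> R.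
Hypothesis mE : is_mean E.

(* The absolute value only matters on non-measurable sets. *)
Let nu (A : set T) : \bar R := `|E \1_A|%:E.

Let nuE A : measurable A -> nu A = (E \1_A)%:E.
Proof.
move=> mA; rewrite /nu ger0_norm//.
exact: (mean_ge0 mE (bounded_mfun_indic mA)).
Qed.

Let nu0 : nu set0 = 0%E.
Proof. by rewrite nuE// indic0 (mean_cst mE). Qed.

Let nu_ge0 A : (0 <= nu A)%E.
Proof. by rewrite lee_fin. Qed.

Let nu_sigma_additive : semi_sigma_additive nu.
Proof.
move=> F mF tF mUF; rewrite nuE//.
have bF i : bounded_mfun (\1_(F i) : T -> R) by exact: bounded_mfun_indic.
have -> : (fun n => \sum_(0 <= i < n) nu (F i))%E =
    (fun n => (E (fun t => \sum_(0 <= i < n) \1_(F i) t))%:E).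
  apply/funext => n.
  under [in RHS]eq_fun do under eq_bigr do rewrite -[\1_(_) _]mul1r.
  rewrite (mean_lincomb mE)// -sumEFin.
  by apply: eq_bigr => i _; rewrite nuE// mul1r.
apply/cvg_EFin; first exact: nearW.
exact: (mean_cvg mE (bounded_cvg_sum_indic mF tF)).
Qed.

Theorem mean_representation : exists nu : probability T R,
  forall f, bounded_mfun f -> E f = \int[nu]_t f t.
Proof.
have nuT : nu setT = 1%E by rewrite nuE// indicT (mean_cst mE).
pose nu_meas := isMeasure.Build _ _ _ nu nu0 nu_ge0 nu_sigma_additive.
pose nu_measure : {measure set T -> \bar R} := HB.pack nu nu_meas.
pose nu_prob := Measure_isProbability.Build _ _ _ nu_measure nuT.
exists (HB.pack nu nu_meas nu_prob : probability T R).
apply: eq_mean (is_mean_Rintegral _) _ => // A mA.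
by rewrite Rintegral_indic// [X in fine X]nuE.
Qed.

End mean_representation.

Lemma is_mean_uniform_lim {d : measure_display} {T : measurableType d}
    {R : realType} (E_ : ((T -> R) -> R)^nat) (E : (T -> R) -> R) (r : R^nat) :
  (forall n, is_mean (E_ n)) -> r @ \oo --> 0 ->
  (forall n (C : R) (f : T -> R), measurable_fun setT f ->
    (forall t, `|f t| <= C) -> `|E_ n f - E f| <= r n * C) ->
  is_mean E.
Proof.
move=> meanE r0 distE.
have rC_small (C e : R) : 0 < e -> \forall n \near \oo, r n * C <= e.
  move=> e0; have : r n * C @[n --> \oo] --> 0.
    by rewrite -[X in _ --> X](mul0r C); exact: cvgMl.
  move=> /cvgr0_norm_le/(_ _ e0); apply: filterS => n.
  exact: le_trans (ler_norm _).
have E_E f : bounded_mfun f -> E_ n f @[n --> \oo] --> E f.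
  move=> [mf [C fC]]; apply/cvgrPdist_le => e e0.
  apply: filterS (rC_small C e e0) => n; apply: le_trans.
  by rewrite distrC; exact: distE.
split=> [a f g bf bg|c|f bf f0|fn f fn_f].
- apply: (cvg_unique _ (E_E _ (bounded_mfun_linear a bf bg))) => //.
  rewrite /=; under eq_fun do rewrite (mean_linear (meanE _))//.
  by apply: cvgD; [apply: cvgMr|]; exact: E_E.
- apply: (cvg_unique _ (E_E _ (bounded_mfun_cst c))) => //.
  by rewrite /=; under eq_fun do rewrite (mean_cst (meanE _)); exact: cvg_cst.
- have cvgE := E_E _ bf; rewrite -(cvg_lim _ cvgE)//.
  apply: limr_ge; first exact: cvgP cvgE.
  by apply: nearW => n; exact: (mean_ge0 (meanE n) bf f0).
- have [mfn [C fnC] _] := fn_f; have [mf [D fD]] := bounded_cvg_lim fn_f.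
  apply/cvgrPdist_lt => e e0; have e3 : 0 < e / 3 by rewrite divr_gt0.
  have [N [CN DN]] : exists N, r N * C <= e / 3 /\ r N * D <= e / 3.
    have [N _ rN] : \forall n \near \oo, r n * C <= e / 3 /\ r n * D <= e / 3.
      by apply: filterI; exact: rC_small.
    by exists N; exact: rN (leqnn N).
  have /cvgrPdist_lt/(_ _ e3) := mean_cvg (meanE N) fn_f.
  apply: filterS => k; have := distE N _ _ (mfn k) (fnC k).
  by have := distE N _ _ mf fD; rewrite !ler_norml !ltr_norml; lra.
Qed.

Section markov_operator.
Context {d : measure_display} {T : measurableType d} {R : realType}.
Implicit Types (P : (T -> R) -> T -> R) (f : T -> R).

Record markov_operator P : Prop := MarkovOperator {
  markov_measurable : forall f, bounded_mfun f -> measurable_fun setT (P f) ;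
  markov_mean : forall t, is_mean (P ^~ t) }.

Lemma markov_bounded_cvg P (fn : (T -> R)^nat) f : markov_operator P ->
  bounded_cvg fn f -> bounded_cvg (P \o fn) (P f).
Proof.
move=> mP fn_f; have bfn n := bounded_cvg_seq n fn_f.
split=> [n||t]; first exact: markov_measurable.
  have [_ [C fC] _] := fn_f; exists C => n t.
  exact: (mean_norm_le (markov_mean mP t) (bfn n) (fC n)).
exact: (mean_cvg (markov_mean mP t) fn_f).
Qed.

Lemma markov_bounded P f : markov_operator P -> bounded_mfun f ->
  bounded_mfun (P f).
Proof.
move=> mP bf; split; first exact: markov_measurable.
have [_ [C fC]] := bf; exists C => t.
exact: (mean_norm_le (markov_mean mP t) bf fC).
Qed.

Lemma is_mean_comp (E : (T -> R) -> R) P : is_mean E -> markov_operator P ->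
  is_mean (E \o P).
Proof.
move=> mE mP; split=> [a f g bf bg|c|f bf f0|fn f fn_f] /=.
- rewrite -(mean_linear mE _ (markov_bounded mP bf) (markov_bounded mP bg)).
  congr E; apply/funext => t.
  exact: (mean_linear (markov_mean mP t)).
- rewrite -[RHS](mean_cst mE); congr E; apply/funext => t.
  exact: (mean_cst (markov_mean mP t)).
- apply: (mean_ge0 mE (markov_bounded mP bf)) => t.
  exact: (mean_ge0 (markov_mean mP t) bf f0).
- exact: (mean_cvg mE (markov_bounded_cvg mP fn_f)).
Qed.

Lemma markov_operator_iter P n : markov_operator P ->
  markov_operator (fun f => iter n P f).
Proof.
move=> mP; elim: n => [|n mPn].
  by split=> [f []//|t]; exact: is_mean_eval.
split=> [f bf|t]; first exact: (markov_measurable mP (markov_bounded mPn bf)).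
exact: (is_mean_comp (markov_mean mP t) mPn).
Qed.

Definition invariant_measure P (nu : {measure set T -> \bar R}) : Prop :=
  forall A, measurable A -> nu A = (\int[nu]_t (P \1_A t)%:E)%E.

Lemma invariant_measureP P (nu : probability T R) : markov_operator P ->
  invariant_measure P nu <->
  (forall f, bounded_mfun f -> \int[nu]_t P f t = \int[nu]_t f t).
Proof.
move=> mP; have mnu := is_mean_Rintegral nu; split=> [inv f bf|inv A mA].
  apply: (eq_mean (is_mean_comp mnu mP) mnu) bf => A mA /=.
  by rewrite Rintegral_indic// inv.
have bA : bounded_mfun (\1_A : T -> R) by exact: bounded_mfun_indic.
rewrite -[LHS]fineK ?fin_num_measure// -Rintegral_indic// -inv// fineK//.
exact/integrable_fin_num/bounded_mfun_integrable/markov_bounded.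
Qed.

End markov_operator.

Section doeblin.
Context {d : measure_display} {T : measurableType d} {R : realType}.
Variables (P : (T -> R) -> T -> R) (E : (T -> R) -> R) (beta : R).
Hypotheses (mP : markov_operator P) (mE : is_mean E) (beta_gt0 : 0 < beta).
Hypothesis minorization : forall f t, bounded_mfun f -> (forall x, 0 <= f x) ->
  beta * E f <= P f t.
Implicit Types f : T -> R.

Local Notation rho := (1 - beta).

Let rho_ge0 : 0 <= rho.
Proof.
have := minorization point (bounded_mfun_cst 1) (fun=> ler01).
by rewrite (mean_cst mE) (mean_cst (markov_mean mP point)) mulr1 subr_ge0.
Qed.

Let cvg_rho (C : R) : rho ^+ n * C @[n --> \oo] --> 0.
Proof.
rewrite -[X in _ --> X](mul0r C); apply: cvgMl; apply: cvg_expr.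
by rewrite (ger0_norm rho_ge0) ltrBlDr ltrDl.
Qed.

Lemma doeblin_range (a b : R) f t :
  bounded_mfun f -> (forall x, a <= f x <= b) ->
  rho * a + beta * E f <= P f t <= rho * b + beta * E f.
Proof.
move=> bf fab.
have lower : beta * E (1 \*o f \+ cst (- a)) <= P (1 \*o f \+ cst (- a)) t.
  apply: minorization => [|x /=]; first exact: bounded_mfun_affine.
  by have := fab x; lra.
have upper : beta * E (-1 \*o f \+ cst b) <= P (-1 \*o f \+ cst b) t.
  apply: minorization => [|x /=]; first exact: bounded_mfun_affine.
  by have := fab x; lra.
move: lower upper.
rewrite !(mean_affine mE)// !(mean_affine (markov_mean mP t))//; lra.
Qed.

Lemma iter_doeblin_range (C : R) f n :
  bounded_mfun f -> (forall t, `|f t| <= C) ->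
  exists c, forall m t, c <= iter (m + n) P f t <= c + rho ^+ n * (2 * C).
Proof.
move=> bf fC; have bPf k : bounded_mfun (iter k P f).
  exact: (markov_bounded (markov_operator_iter k mP) bf).
suff [c fc] : exists c, forall t, c <= iter n P f t <= c + rho ^+ n * (2 * C).
  exists c => m t; rewrite iterD.
  exact: (mean_range (markov_mean (markov_operator_iter m mP) t) (bPf n) fc).
elim: n => [|n [c fc]].
  by exists (- C) => t; have := fC t; rewrite ler_norml expr0 /=; lra.
exists (rho * c + beta * E (iter n P f)) => t.
by have := doeblin_range t (bPf n) fc; rewrite exprS /=; lra.
Qed.

Definition stationary_mean f := limn (fun n => iter n P f point).

Lemma is_cvg_iter_doeblin f : bounded_mfun f ->
  cvgn (fun n => iter n P f point).
Proof.
move=> bf; have [_ [C fC]] := bf.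
apply/cauchy_cvgP/cauchy_exP => e e0.
have /cvgr0_norm_lt/(_ _ e0)[n _ /(_ n (leqnn n)) rho_e] := cvg_rho (2 * C).
have [c fc] := iter_doeblin_range n bf fC.
exists (iter n P f point), n => // k /= nk; rewrite /ball /=.
apply: le_lt_trans rho_e; rewrite -(subnK nk).
have := fc (k - n)%N point; have := fc 0 point; rewrite add0n.
set D := rho ^+ n * _ => ? ?.
by rewrite (le_trans _ (ler_norm D))// ler_norml; lra.
Qed.

Lemma dist_iter_stationary_mean (C : R) f n t : bounded_mfun f ->
  (forall t, `|f t| <= C) ->
  `|iter n P f t - stationary_mean f| <= rho ^+ n * (2 * C).
Proof.
move=> bf fC; have [c fc] := iter_doeblin_range n bf fC.
have := fc 0 t; rewrite add0n.
have cvg_f := is_cvg_iter_doeblin bf.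
have near_range : \forall k \near \oo,
    c <= iter k P f point <= c + rho ^+ n * (2 * C).
  by exists n => // k /= nk; rewrite -(subnK nk).
have : c <= stationary_mean f.
  by apply: limr_ge => //; apply: filterS near_range => k /andP[].
have : stationary_mean f <= c + rho ^+ n * (2 * C).
  by apply: limr_le => //; apply: filterS near_range => k /andP[].
by rewrite ler_norml; lra.
Qed.

Lemma is_mean_stationary_mean : is_mean stationary_mean.
Proof.
apply: (@is_mean_uniform_lim _ _ _ (fun n f => iter n P f point) _
  (fun n => rho ^+ n * 2)).
- by move=> n; exact: (markov_mean (markov_operator_iter n mP)).
- exact: cvg_rho.
- move=> n C f mf fC; rewrite -mulrA; apply: dist_iter_stationary_mean => //.
  by split=> //; exists C.
Qed.

Lemma stationary_mean_markov f : bounded_mfun f ->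
  stationary_mean (P f) = stationary_mean f.
Proof.
move=> bf; have cvgf : iter n P f point @[n --> \oo] --> stationary_mean f.
  exact: is_cvg_iter_doeblin.
rewrite -(cvg_shiftS (fun n => iter n P f point)) in cvgf.
rewrite -(cvg_lim _ cvgf)// /stationary_mean.
by under eq_fun do rewrite -iterSr.
Qed.

Lemma invariant_mean_unique (E' : (T -> R) -> R) f : is_mean E' ->
  (forall g, bounded_mfun g -> E' (P g) = E' g) -> bounded_mfun f ->
  E' f = stationary_mean f.
Proof.
move=> mE' E'P bf; have [_ [C fC]] := bf.
have bPf n := markov_bounded (markov_operator_iter n mP) bf.
have E'iter n : E' (iter n P f) = E' f by elim: n => //= n <-; exact: E'P.
have dist n : `|E' f - stationary_mean f| <= rho ^+ n * (2 * C).
  have near_mean t : stationary_mean f - rho ^+ n * (2 * C) <= iter n P f t <=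
      stationary_mean f + rho ^+ n * (2 * C).
    by have := dist_iter_stationary_mean n t bf fC; rewrite ler_norml; lra.
  have := mean_range mE' (bPf n) near_mean.
  by rewrite E'iter ler_norml; lra.
apply/eqP; rewrite -subr_eq0 -normr_le0.
by apply: (cvgr_to_ge (cvg_rho (2 * C))); exact: nearW.
Qed.

Theorem doeblin_ergodic : exists nu : probability T R,
  [/\ invariant_measure P nu,
      (forall nu' : probability T R, invariant_measure P nu' ->
        forall A, measurable A -> nu' A = nu A) &
      (forall (C : R) f n t, bounded_mfun f -> (forall x, `|f x| <= C) ->
        `|iter n P f t - \int[nu]_x f x| <= rho ^+ n * (2 * C))].
Proof.
have [nu nuE] := mean_representation is_mean_stationary_mean.
exists nu; split=> [|nu' inv A mA|C f n t bf fC].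
- apply/(invariant_measureP _ mP) => f bf.
  by rewrite -!nuE ?stationary_mean_markov//; exact: markov_bounded.
- have bA : bounded_mfun (\1_A : T -> R) by exact: bounded_mfun_indic.
  rewrite -[LHS]fineK ?fin_num_measure// -[RHS]fineK ?fin_num_measure//.
  rewrite -!Rintegral_indic// -nuE//; congr EFin.
  apply: (invariant_mean_unique (is_mean_Rintegral nu')) => //.
  exact/invariant_measureP.
- by rewrite -nuE//; exact: dist_iter_stationary_mean.
Qed.

End doeblin.

Lemma measurable_fun_Rintegral {d d' : measure_display} {T : measurableType d}
    {S : measurableType d'} {R : realType}
    (mu : {sigma_finite_measure set S -> \bar R}) (F : T * S -> R) :
  measurable_fun setT F -> measurable_fun setT (fun t => \int[mu]_s F (t, s)).
Proof.
move=> mF; have mEF : measurable_fun setT (EFin \o F) by exact/measurable_EFinP.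
apply: (measurableT_comp (@fine_measurable R setT measurableT)) => /=.
under eq_fun do rewrite integralE; apply: emeasurable_funB.
- have := @measurable_fun_fubini_tonelli_F _ _ _ _ _ mu _
    (measurable_funepos mEF) (funepos_ge0 _).
  apply: eq_measurable_fun => t _; apply: eq_integral => s _.
  by rewrite !funeposE.
- have := @measurable_fun_fubini_tonelli_F _ _ _ _ _ mu _
    (measurable_funeneg mEF) (funeneg_ge0 _).
  apply: eq_measurable_fun => t _; apply: eq_integral => s _.
  by rewrite !funenegE.
Qed.

Lemma measurable_fun_inv_ge0 {d : measure_display} {T : measurableType d}
    {R : realType} (f : T -> R) : (forall t, 0 <= f t) ->
  measurable_fun setT f -> measurable_fun setT (fun t => (f t)^-1).
Proof.
move=> f0 mf; under eq_fun do rewrite -powR_inv1//.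
by apply: (measurableT_comp (measurable_powR (-1))).
Qed.

Lemma Rintegral_gt0 {d : measure_display} {T : measurableType d} {R : realType}
    (mu : {measure set T -> \bar R}) (w : T -> R) :
  (0 < mu setT)%E -> (forall t, 0 < w t) -> mu.-integrable setT (EFin \o w) ->
  0 < \int[mu]_t w t.
Proof.
move=> muT w0 iw.
rewrite lt_neqAle Rintegral_ge0 ?andbT; last by move=> t _; exact: ltW.
apply/negP => /eqP w_0.
have : (\int[mu]_x `|(w x)%:E| = 0)%E.
  rewrite (eq_integral (EFin \o w)); last by move=> t _ /=; rewrite gtr0_norm.
  by rewrite -(fineK (integrable_fin_num measurableT iw)) [X in X%:E](esym w_0).
move/(ae_eq_integral_abs mu measurableT (measurable_int _ iw)).
move=> [N [mN N0 wN]].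
move: muT; rewrite (_ : setT = N) ?N0 ?ltxx//.
apply/esym/seteqP; split=> // t _; apply: wN => /= /(_ I) [] wt.
by have := w0 t; rewrite wt ltxx.
Qed.

Lemma bigcup_measurable_countable {d : measure_display} {T : measurableType d}
    {I : Type} (D : set I) (F : I -> set T) : countable D ->
  (forall i, D i -> measurable (F i)) -> measurable (\bigcup_(i in D) F i).
Proof.
move=> /pfcard_geP[->|/unsquash u] mF; first by rewrite bigcup_set0.
rewrite -(surj_image_eq _ (@surj _ _ _ _ u)) ?bigcup_image//.
by apply: bigcup_measurable => n _; exact/mF/funS.
Qed.

Lemma measurable_fun_g_sigma_algebra {d : measure_display}
    {S : measurableType d} (T : pointedType) (G : set_system T)
    (h : S -> g_sigma_algebraType G) :
  (forall U, G U -> measurable (h @^-1` U)) -> measurable_fun setT h.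
Proof.
move=> mh; apply: (@measurability _ _ S (g_sigma_algebraType G) setT h G) => //.
by move=> _ [U GU <-]; rewrite setTI; exact: mh.
Qed.

Lemma measurable_borel_fst (T1 T2 : ptopologicalType) :
  measurable_fun setT (fst : borel (T1 * T2)%type -> borel T1).
Proof.
apply: measurable_fun_g_sigma_algebra => U oU; apply: sub_sigma_algebra.
by apply: open_comp => // x _; exact: cvg_fst.
Qed.

Lemma measurable_borel_snd (T1 T2 : ptopologicalType) :
  measurable_fun setT (snd : borel (T1 * T2)%type -> borel T2).
Proof.
apply: measurable_fun_g_sigma_algebra => U oU; apply: sub_sigma_algebra.
by apply: open_comp => // x _; exact: cvg_snd.
Qed.

Lemma separable_second_countable (R : realType) (V : pseudoPMetricType R) :
  separable_space V -> @second_countable V.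
Proof.
move=> [D [cD dD]].
pose B n (y : V) : set V := (ball y (n.+1%:R^-1 : R))°.
exists (\bigcup_n (B n @` D)).
  apply: bigcup_countable => // n _.
  exact: sub_countable (card_image_le _ _) cD.
split=> [_ [n _ [y _ <-]]|x U /nbhs_ballP[e /= e0 eU]].
  exact: open_interior.
have e2 : 0 < e / 2 by rewrite divr_gt0.
have [n _ /(_ n (leqnn n)) /= ne] := near_infty_natSinv_lt (PosNum e2).
have r2 : 0 < (n.+1%:R^-1 : R) / 2 by rewrite divr_gt0.
have [y [Dy xy]] : D `&` ball x ((n.+1%:R^-1 : R) / 2) !=set0.
  by have : closure D x by [rewrite dD]; apply; exact: nbhsx_ballx.
exists (B n y).
  split; first by exists n => //; exists y.
  apply: filterS (nbhsx_ballx x _ r2) => z xz.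
  by rewrite [n.+1%:R^-1]splitr; exact: ball_triangle (ball_sym xy) xz.
move=> z /interior_subset yz; apply: eU; rewrite /= [e]splitr.
apply: ball_triangle (le_ball _ xy) (le_ball (ltW ne) yz).
by rewrite (le_trans _ (ltW ne))// ler_pdivrMr// ler_peMr// ler1n.
Qed.

(* A countable basis makes every open set of the product a countable union of
   open rectangles. *)
Lemma measurable_borel_pair {d : measure_display} {S : measurableType d}
    (T1 T2 : ptopologicalType) (g : S -> borel T1) (h : S -> borel T2) :
  @second_countable T1 -> @second_countable T2 ->
  measurable_fun setT g -> measurable_fun setT h ->
  measurable_fun setT ((fun s => (g s, h s)) : S -> borel (T1 * T2)%type).
Proof.
move=> [B1 cB1 [oB1 nB1]] [B2 cB2 [oB2 nB2]] mg mh.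
apply: measurable_fun_g_sigma_algebra => U oU.
pose rects :=
  [set W : set T1 * set T2 | [/\ B1 W.1, B2 W.2 & W.1 `*` W.2 `<=` U]].
have crects : countable rects.
  apply: (@sub_countable _ _ _ (B1 `*` B2)); last exact: countableX.
  by apply: subset_card_le => W [].
rewrite (_ : _ @^-1` U = \bigcup_(W in rects) (g @^-1` W.1 `&` h @^-1` W.2)).
  apply: bigcup_measurable_countable => // W [B1W B2W _].
  apply: measurableI; rewrite -[X in measurable X]setTI.
  - by apply: mg => //; apply: sub_sigma_algebra; exact: oB1.
  - by apply: mh => //; apply: sub_sigma_algebra; exact: oB2.
apply/seteqP; split=> [s /= Us|s [W [_ _ WU] [gW hW]]]; last exact: WU.
have [[W1 W2] [nW1 nW2] WU] : nbhs (g s, h s) U by exact: open_nbhs_nbhs.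
have [V1 [BV1 gV1] V1W] := nB1 _ _ nW1.
have [V2 [BV2 hV2] V2W] := nB2 _ _ nW2.
exists (V1, V2) => //; split=> // -[x y] [/V1W W1x /V2W W2y].
exact: (WU (x, y)).
Qed.

Lemma compact_sublevel_dominated {R : realType} {T : topologicalType}
    (p q : T -> R) (c : R) :
  continuous p -> continuous q -> (forall z, 0 < p z) -> (forall z, 0 < q z) ->
  0 < c -> compact [set z | q z / p z <= c] ->
  \forall M \near +oo, forall z, p z <= M * q z.
Proof.
move=> cp cq p_gt0 q_gt0 c_gt0 cK.
have cpq : continuous (fun z => p z / q z).
  by move=> z; apply: cvgM; [exact: cp|apply: cvgV; [rewrite gt_eqF|exact: cq]].
have [B [_ pqB]] := compact_bounded (continuous_compact
  (continuous_subspaceT cpq) cK).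
near=> M => z; rewrite -ler_pdivrMr//.
have [qpc|cqp] := leP (q z / p z) c.
  apply: (le_trans (ler_norm _)); apply: (pqB M); last by exists z.
  by near: M; apply: nbhs_pinfty_gt; exact: num_real.
have cM : c^-1 <= M by near: M; apply: nbhs_pinfty_ge; exact: num_real.
rewrite (le_trans _ cM)// -invf_div lef_pV2 ?posrE ?divr_gt0//.
exact: ltW.
Unshelve. all: by end_near. Qed.

Section acceptance.
Context {R : realType} {V : normedModType R}.
Variables p q : V -> R.
Hypotheses (p_gt0 : forall z, 0 < p z) (q_gt0 : forall z, 0 < q z).

Lemma alpha_itv01 x z : 0 <= alpha p q x z <= 1.
Proof. by rewrite le_min ler01 ge_min lexx /= divr_ge0 ?mulr_ge0 ?ltW. Qed.

(* The domination is used at z if the minimum in alpha is 1, and at x if not. *)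
Lemma alpha_minorization (M : R) x z : 0 < M -> (forall y, p y <= M * q y) ->
  p z / M <= alpha p q x z * q z.
Proof.
move=> M0 pMq; rewrite /alpha; have [_|_] := leP 1 (p z * q x / (p x * q z)).
  by rewrite mul1r ler_pdivrMr// mulrC.
rewrite ler_pdivrMr//.
have -> : p z * q x / (p x * q z) * q z * M = p z * (M * q x / p x).
  by field; rewrite !gt_eqF.
by apply: ler_peMr; rewrite ?ler_pdivlMr// ?mul1r// ltW.
Qed.

Lemma measurable_alpha {d : measure_display} {S : measurableType d}
    (g h : S -> borel V) :
  measurable_fun setT (p : borel V -> R) ->
  measurable_fun setT (q : borel V -> R) ->
  measurable_fun setT g -> measurable_fun setT h ->
  measurable_fun setT (fun s => alpha p q (g s) (h s)).
Proof.
move=> mp mq mg mh.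
have mpg := measurableT_comp mp mg; have mph := measurableT_comp mp mh.
have mqg := measurableT_comp mq mg; have mqh := measurableT_comp mq mh.
apply: measurable_minr => //; apply: measurable_funM.
  exact: measurable_funM mph mqg.
apply: measurable_fun_inv_ge0; last exact: measurable_funM mpg mqh.
by move=> s; rewrite ltW// mulr_gt0.
Qed.

End acceptance.

Section density.
Context {R : realType} {V : normedModType R}.
Variable mu : {measure set (borel V) -> \bar R}.
Variable w : V -> R.
Hypothesis w_density : is_density mu w.

Lemma density_integrable : mu.-integrable setT (EFin \o (w : borel V -> R)).
Proof.
have [w0 [mw w1]] := w_density.
apply/integrableP; split; first exact/measurable_EFinP.
rewrite (eq_integral (fun z : borel V => (w z)%:E)) ?w1 ?ltry// => z _.
by rewrite /= ger0_norm.
Qed.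

Lemma Rintegral_density : \int[mu]_z w z = 1.
Proof. by have [_ [_ w1]] := w_density; rewrite /Rintegral w1. Qed.

End density.

Section coupled_kernel.
Context {R : realType} {V : normedModType R}.
Variables (mu : probability (borel V) R) (pa pb Q : V -> R).
Hypothesis Vsep : separable_space V.
Hypotheses (pa_density : is_density mu pa) (pb_density : is_density mu pb).
Hypothesis Q_density : is_density mu Q.
Hypotheses (pa_gt0 : forall z, 0 < pa z) (pb_gt0 : forall z, 0 < pb z).
Hypothesis Q_gt0 : forall z, 0 < Q z.
Local Notation V2 := (borel (V * V)%type).
Implicit Types (f : V2 -> R) (t : V * V) (z : V).

Definition accept_both t z : R :=
  Num.min (alpha pa Q t.1 z) (alpha pb Q t.2 z).
Definition accept_fst t z : R :=
  Num.max 0 (alpha pa Q t.1 z - alpha pb Q t.2 z).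
Definition accept_snd t z : R :=
  Num.max 0 (alpha pb Q t.2 z - alpha pa Q t.1 z).
Definition reject_both t z : R :=
  1 - Num.max (alpha pa Q t.1 z) (alpha pb Q t.2 z).

Lemma acceptance_ge0 t z : [/\ 0 <= accept_both t z, 0 <= accept_fst t z,
  0 <= accept_snd t z & 0 <= reject_both t z].
Proof.
have /andP[a0 a1] := alpha_itv01 pa_gt0 Q_gt0 t.1 z.
have /andP[b0 b1] := alpha_itv01 pb_gt0 Q_gt0 t.2 z.
rewrite /accept_both /accept_fst /accept_snd /reject_both subr_ge0.
by rewrite le_min !le_max ge_max lexx a0 a1 b0 b1.
Qed.

Lemma acceptance_sum t z :
  accept_both t z + accept_fst t z + accept_snd t z + reject_both t z = 1.
Proof.
rewrite /accept_both /accept_fst /accept_snd /reject_both.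
set a := alpha pa Q _ _; set b := alpha pb Q _ _.
by rewrite minEle !maxEle; do !case: leP => ?; lra.
Qed.

Lemma acceptance_bounded_mfun {d : measure_display} {S : measurableType d}
    (g : S -> V2) (h : S -> borel V) :
  measurable_fun setT g -> measurable_fun setT h ->
  [/\ bounded_mfun (fun s => accept_both (g s) (h s)),
      bounded_mfun (fun s => accept_fst (g s) (h s)),
      bounded_mfun (fun s => accept_snd (g s) (h s)) &
      bounded_mfun (fun s => reject_both (g s) (h s))].
Proof.
move=> mg mh.
have ma : measurable_fun setT (fun s => alpha pa Q (g s).1 (h s)).
  apply: measurable_alpha => //; [exact: pa_density.2.1|exact: Q_density.2.1|].
  exact: (measurableT_comp (@measurable_borel_fst V V) mg).
have mb : measurable_fun setT (fun s => alpha pb Q (g s).2 (h s)).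
  apply: measurable_alpha => //; [exact: pb_density.2.1|exact: Q_density.2.1|].
  exact: (measurableT_comp (@measurable_borel_snd V V) mg).
have bounded1 (u : S -> R) : measurable_fun setT u ->
    (forall s, 0 <= u s <= 1) -> bounded_mfun u.
  move=> meas_u u01; split=> //; exists 1 => s.
  by rewrite ler_norml; have := u01 s; lra.
split; apply: bounded1; try by move=> s;
  have [] := acceptance_ge0 (g s) (h s);
  have := acceptance_sum (g s) (h s); lra.
- exact: measurable_minr.
- by apply: measurable_maxr => //; exact: measurable_funB.
- by apply: measurable_maxr => //; exact: measurable_funB.
- by apply: measurable_funB => //; exact: measurable_maxr.
Qed.

(* For a fixed proposal [z], the expectation of [f] over the accept/reject
   decision. *)
Definition coupled_mix f t z : R :=
  accept_both t z * f (z, z) + accept_fst t z * f (z, t.2) +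
  accept_snd t z * f (t.1, z) + reject_both t z * f t.

Lemma is_mean_coupled_mix t z : is_mean (fun f => coupled_mix f t z).
Proof.
have [both0 fst0 snd0 reject0] := acceptance_ge0 t z.
rewrite /coupled_mix; split=> [a f g _ _|c|f _ f0|fn f [_ _ fn_f]].
- by rewrite /=; ring.
- by rewrite -!mulrDl acceptance_sum mul1r.
- by rewrite !addr_ge0// mulr_ge0.
- by repeat apply: cvgD; apply: cvgMr; exact: fn_f.
Qed.

Lemma bounded_mfun_coupled_terms {d : measure_display} {S : measurableType d}
    f (g : S -> V2) (h : S -> borel V) :
  bounded_mfun f -> measurable_fun setT g -> measurable_fun setT h ->
  [/\ bounded_mfun (fun s => accept_both (g s) (h s) * f (h s, h s)),
      bounded_mfun (fun s => accept_fst (g s) (h s) * f (h s, (g s).2)),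
      bounded_mfun (fun s => accept_snd (g s) (h s) * f ((g s).1, h s)) &
      bounded_mfun (fun s => reject_both (g s) (h s) * f (g s))].
Proof.
move=> bf mg mh; have V2nd := separable_second_countable Vsep.
have mg1 : measurable_fun setT (fun s => (g s).1 : borel V).
  exact: (measurableT_comp (@measurable_borel_fst V V) mg).
have mg2 : measurable_fun setT (fun s => (g s).2 : borel V).
  exact: (measurableT_comp (@measurable_borel_snd V V) mg).
have bf_pair (k1 k2 : S -> borel V) : measurable_fun setT k1 ->
    measurable_fun setT k2 -> bounded_mfun (fun s => f (k1 s, k2 s)).
  move=> mk1 mk2.
  apply: (bounded_mfun_comp (h := fun s => (k1 s, k2 s) : V2)) => //.
  exact: measurable_borel_pair.
have [] := acceptance_bounded_mfun mg mh.
split; apply: bounded_mfunM => //; try exact: bf_pair.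
exact: bounded_mfun_comp mg.
Qed.

Lemma bounded_mfun_coupled_mix {d : measure_display} {S : measurableType d}
    f (g : S -> V2) (h : S -> borel V) :
  bounded_mfun f -> measurable_fun setT g -> measurable_fun setT h ->
  bounded_mfun (fun s => coupled_mix f (g s) (h s)).
Proof.
move=> bf mg mh; have [_ [C fC]] := bf; split; last first.
  exists C => s; exact: (mean_norm_le (is_mean_coupled_mix (g s) (h s)) bf fC).
have [[m1 _] [m2 _] [m3 _] [m4 _]] := bounded_mfun_coupled_terms bf mg mh.
by do 2!apply: measurable_funD => //; exact: measurable_funD.
Qed.

Local Notation P := (Pop mu pa pb Q).

Lemma Rintegral_reject_both t : \int[mu]_z (reject_both t z * Q z) =
  1 - \int[mu]_z (Num.max (alpha pa Q t.1 z) (alpha pb Q t.2 z) * Q z).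
Proof.
have iQ := density_integrable Q_density.
have mt : measurable_fun setT (fun _ : borel V => t : V2) by [].
have mid : measurable_fun setT (fun z : borel V => z) by [].
have [_ _ _ breject] := acceptance_bounded_mfun mt mid.
have ireject := bounded_mfunM_integrable iQ breject.
rewrite -(Rintegral_density Q_density).
apply: (canRL (subKr _)); rewrite -RintegralB//.
by apply: eq_Rintegral => z _; rewrite /reject_both; ring.
Qed.

Lemma PopE f t : bounded_mfun f -> P f t = \int[mu]_z (coupled_mix f t z * Q z).
Proof.
move=> bf; have iQ := density_integrable Q_density.
have mt : measurable_fun setT (fun _ : borel V => t : V2) by [].
have mid : measurable_fun setT (fun z : borel V => z) by [].
have [_ _ _ breject] := acceptance_bounded_mfun mt mid.
have [b1 b2 b3 _] := bounded_mfun_coupled_terms bf mt mid.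
have i1 := bounded_mfunM_integrable iQ b1.
have i2 := bounded_mfunM_integrable iQ b2.
have i3 := bounded_mfunM_integrable iQ b3.
have ireject := bounded_mfunM_integrable iQ breject.
rewrite /Pop -Rintegral_reject_both -RintegralZl//.
have i12 := integrableD measurableT i1 i2.
have i123 := integrableD measurableT i12 i3.
rewrite -RintegralD// -RintegralD// -RintegralD//; last first.
  exact: (integrableZl measurableT (f t) ireject).
apply: eq_Rintegral => z _.
by rewrite /coupled_mix /accept_both /accept_fst /accept_snd; ring.
Qed.

Lemma bounded_mfun_coupled_mix_cst f t : bounded_mfun f ->
  bounded_mfun (coupled_mix f t : borel V -> R).
Proof.
by move=> bf; apply: (bounded_mfun_coupled_mix (g := fun=> t : V2) (h := id)).
Qed.

Lemma markov_Pop : markov_operator (P : (V2 -> R) -> V2 -> R).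
Proof.
have mQ : measurable_fun setT (Q : borel V -> R) by exact: Q_density.2.1.
split=> [f bf|t].
  have -> : P f = fun t => \int[mu]_z (coupled_mix f t z * Q z).
    by apply/funext => t; rewrite PopE.
  apply: (measurable_fun_Rintegral mu (F := fun x : V2 * borel V =>
    coupled_mix f x.1 x.2 * Q x.2)).
  apply: measurable_funM; last exact: measurableT_comp mQ measurable_snd.
  exact: (bounded_mfun_coupled_mix bf (@measurable_fst _ _ V2 (borel V))
    measurable_snd).1.
apply: eq_is_mean (is_mean_mixture (density_integrable Q_density) _
  (Rintegral_density Q_density) _ (is_mean_coupled_mix t)).
- by move=> f bf; rewrite PopE.
- by move=> z; exact: ltW.
- by move=> f /(bounded_mfun_coupled_mix_cst t)[].
Qed.

Definition overlap z : R := Num.min (pa z) (pb z).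
Definition overlap_mass : R := \int[mu]_z overlap z.
Definition overlap_density z : R := overlap z / overlap_mass.
Definition diagonal_mean f : R := \int[mu]_z (f (z, z) * overlap_density z).

Let overlap_gt0 z : 0 < overlap z.
Proof. by rewrite lt_min pa_gt0 pb_gt0. Qed.

Lemma overlap_integrable :
  mu.-integrable setT (EFin \o (overlap : borel V -> R)).
Proof.
apply: (le_integrable measurableT _ _ (density_integrable pa_density)).
- apply/measurable_EFinP; exact: measurable_minr pa_density.2.1 pb_density.2.1.
- move=> z _ /=; rewrite lee_fin (gtr0_norm (overlap_gt0 z)).
  by rewrite (gtr0_norm (pa_gt0 z)) ge_min lexx.
Qed.

Lemma overlap_mass_itv01 : 0 < overlap_mass <= 1.
Proof.
rewrite Rintegral_gt0//=; last exact: overlap_integrable; last first.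
  by rewrite [X in (_ < X)%E](probability_setT mu).
rewrite -(Rintegral_density pa_density); apply: le_Rintegral => //.
- exact: overlap_integrable.
- exact: density_integrable.
- by move=> z _; rewrite ge_min lexx.
Qed.

Lemma overlap_density_integrable :
  mu.-integrable setT (EFin \o (overlap_density : borel V -> R)).
Proof.
have := integrableZl measurableT overlap_mass^-1 overlap_integrable.
by apply: eq_integrable => // z _; rewrite /= -EFinM mulrC.
Qed.

Lemma bounded_mfun_diagonal f : bounded_mfun f ->
  bounded_mfun (fun z : borel V => f (z, z)).
Proof.
move=> bf.
apply: (bounded_mfun_comp (h := fun z : borel V => (z, z) : V2)) => //.
by apply: measurable_borel_pair => //; exact: separable_second_countable.
Qed.

Lemma is_mean_diagonal_mean : is_mean diagonal_mean.
Proof.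
have /andP[mass_gt0 _] := overlap_mass_itv01.
apply: (@is_mean_mixture _ _ V2 (borel V) R mu overlap_density
  overlap_density_integrable _ _ (fun f z => f (z, z))).
- by move=> z; rewrite divr_ge0// ltW.
- rewrite /overlap_density; under eq_Rintegral do rewrite mulrC.
  by rewrite RintegralZl ?mulVf ?gt_eqF//; exact: overlap_integrable.
- by move=> f /bounded_mfun_diagonal[].
- by move=> z; exact: is_mean_eval.
Qed.

Section minorization.
Variable M : R.
Hypothesis M_gt0 : 0 < M.
Hypothesis pa_le : forall z, pa z <= M * Q z.
Hypothesis pb_le : forall z, pb z <= M * Q z.

Lemma accept_both_minorization t z : overlap z / M <= accept_both t z * Q z.
Proof.
rewrite [leRHS]minr_pMl ?(ltW (Q_gt0 z))// le_min; apply/andP; split.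
- apply: le_trans (alpha_minorization pa_gt0 Q_gt0 t.1 z M_gt0 pa_le).
  by rewrite ler_wpM2r ?invr_ge0 ?(ltW M_gt0)// ge_min lexx.
- apply: le_trans (alpha_minorization pb_gt0 Q_gt0 t.2 z M_gt0 pb_le).
  by rewrite ler_wpM2r ?invr_ge0 ?(ltW M_gt0)// ge_min lexx orbT.
Qed.

Lemma coupled_mix_minorization f t z : (forall x, 0 <= f x) ->
  f (z, z) * (overlap z / M) <= coupled_mix f t z * Q z.
Proof.
move=> f0; have [_ fst0 snd0 reject0] := acceptance_ge0 t z.
apply: (@le_trans _ _ (f (z, z) * (accept_both t z * Q z))).
  by rewrite ler_wpM2l// accept_both_minorization.
rewrite mulrCA mulrA ler_wpM2r ?(ltW (Q_gt0 z))//.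
by rewrite /coupled_mix -!addrA lerDl !addr_ge0// mulr_ge0.
Qed.

Lemma Pop_minorization f t : bounded_mfun f -> (forall x, 0 <= f x) ->
  overlap_mass / M * diagonal_mean f <= P f t.
Proof.
move=> bf f0; rewrite PopE//.
have i_diag := bounded_mfunM_integrable overlap_density_integrable
  (bounded_mfun_diagonal bf).
rewrite -RintegralZl//; apply: le_Rintegral => //.
- exact: (integrableZl measurableT (overlap_mass / M) i_diag).
- apply: (bounded_mfunM_integrable (density_integrable Q_density)).
  exact: bounded_mfun_coupled_mix_cst.
- move=> z _; apply: le_trans (coupled_mix_minorization t z f0).
  have /andP[mass_gt0 _] := overlap_mass_itv01.
  rewrite (_ : overlap_mass / M * _ = f (z, z) * (overlap z / M))//.
  by rewrite /overlap_density; field; rewrite !gt_eqF.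
Qed.

End minorization.

Theorem coupled_chain_ergodic (c : R) :
  continuous pa -> continuous pb -> continuous Q -> 0 < c ->
  compact [set z | Q z / pa z <= c] -> compact [set z | Q z / pb z <= c] ->
  exists (nu : probability V2 R) (beta : R), 0 < beta < 1 /\
  [/\ kernel_invariant mu pa pb Q nu,
      (forall nu' : probability V2 R, kernel_invariant mu pa pb Q nu' ->
        forall A : set V2, measurable A -> nu' A = nu A) &
      (forall (C : R) f n t, bounded_mfun f -> (forall x, `|f x| <= C) ->
        `|iter n P f t - \int[nu]_x f x| <= (1 - beta) ^+ n * (2 * C))].
Proof.
move=> cpa cpb cQ c_gt0 Ka Kb.
near (pinfty_nbhs R) => M; have M_gt1 : 1 < M by near: M; exact: nbhs_pinfty_gt.
have M_gt0 : 0 < M by exact: lt_trans M_gt1.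
have pa_le : forall z, pa z <= M * Q z.
  by near: M; exact: compact_sublevel_dominated Ka.
have pb_le : forall z, pb z <= M * Q z.
  by near: M; exact: compact_sublevel_dominated Kb.
have /andP[mass_gt0 mass_le1] := overlap_mass_itv01.
have beta_gt0 : 0 < overlap_mass / M by rewrite divr_gt0.
have [nu ergodic] := doeblin_ergodic markov_Pop is_mean_diagonal_mean beta_gt0
  (Pop_minorization M_gt0 pa_le pb_le).
exists nu, (overlap_mass / M); split=> //.
by rewrite beta_gt0 ltr_pdivrMr// mul1r (le_lt_trans mass_le1).
Unshelve. all: by end_near. Qed.

End coupled_kernel.

Theorem mainTheorem1 (R : realType) (V : completeNormedModType R)
  (Vsep : separable_space V)
  (mu : probability (borel V) R)
  (L : nat) (pi : nat -> V -> R) (Q : nat -> V -> R)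
  (* each mu^y_j, j = 0..L, is a probability measure with density pi j *)
  (Hpi : forall j, (j <= L)%N -> is_density mu (pi j))
  (* each Q_l, l = 1..L, is a probability density *)
  (HQ : forall l, (1 <= l <= L)%N -> is_density mu (Q l))
  (* Assumption 1.1 *)
  (A11 : forall l, (1 <= l <= L)%N ->
     continuous (Q l) /\ forall z, 0 < Q l z)
  (* Assumption 1.2 *)
  (A12 : forall j, (j <= L)%N -> continuous (pi j) /\ forall z, 0 < pi j z)
  (* Assumption 1.3 *)
  (A13 : forall l, (1 <= l <= L)%N -> forall j : nat, (j == l.-1) || (j == l) ->
     forall cr : R, 0 < cr -> compact [set th : V | Q l th / pi j th <= cr])
  (* Assumption 1.4 *)
  (A14 : exists c : R, 0 < c < 1 /\
     forall l, (1 <= l <= L)%N -> forall j : nat, (j == l.-1) || (j == l) ->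
       (c%:E <= ess_inf mu (fun z : borel V => (Q l z / pi j z)%:E))%E)
  (* Assumption 1.5 *)
  (A15 : exists r : R, 1 < r /\ exists Cr : R, 0 < Cr /\
     forall l, (1 <= l <= L)%N ->
       (\int[mu]_z ((Q l z) `^ r)%:E <= Cr%:E)%E) :
  forall l, (1 <= l <= L)%N ->
  exists nu : probability (borel (V * V)%type) R,
    (* (1) nu is the unique invariant probability measure *)
    kernel_invariant mu (pi l.-1) (pi l) (Q l) nu /\
    (forall nu' : probability (borel (V * V)%type) R,
       kernel_invariant mu (pi l.-1) (pi l) (Q l) nu' ->
       forall A : set (borel (V * V)%type), measurable A -> nu' A = nu A) /\
    (* (2) uniform ergodicity *)
    exists (W : borel (V * V)%type -> R) (Vmax : R),
      (forall t, 1 <= W t <= Vmax) /\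
      nu.-integrable setT (EFin \o W) /\
      exists (r M : R), 0 < r < 1 /\ 0 < M /\
        forall f : borel (V * V)%type -> R, measurable_fun setT f ->
          (forall t, `|f t| <= W t) ->
          forall (t : V * V) (n : nat),
            `| iter n (fun g => Pop mu (pi l.-1) (pi l) (Q l) g) f t
               - \int[nu]_x f x | <= M * Vmax * r ^+ n.

Proof.
move=> l lL; have /andP[_ lL'] := lL.
have lL1 : (l.-1 <= L)%N by rewrite (leq_trans (leq_pred l)).
have [cQ Q0] := A11 l lL.
have [ca a0] := A12 _ lL1; have [cb b0] := A12 _ lL'.
have Ka : compact [set z | Q l z / pi l.-1 z <= 1].
  by apply: A13; rewrite ?eqxx.
have Kb : compact [set z | Q l z / pi l z <= 1].
  by apply: A13; rewrite ?eqxx ?orbT.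
have [nu [beta [beta01 [inv uniq rate]]]] := coupled_chain_ergodic Vsep
  (Hpi _ lL1) (Hpi _ lL') (HQ _ lL) a0 b0 Q0 ca cb cQ ltr01 Ka Kb.
exists nu; do 2!split=> //.
exists (cst 1), 1; split; first by move=> t; rewrite !lexx.
split; first exact: (bounded_mfun_integrable nu (bounded_mfun_cst 1)).
exists (1 - beta), 2; split; first by lra.
split=> // f mf f1 t n; rewrite mulrC.
by apply: rate => //; split=> //; exists 1.
Qed.
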